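(* Let $s\ge 0$ and $t\ge 1$ be integers, and let $a_1\ge a_2\ge\cdots\ge a_s\ge 3$ be odd integers. Let $\mu_0$ be the partition obtained by sorting the list $[a_1,\dots,a_s,2,2^2,\dots,2^{t-1}]$ in non-increasing order (when $t=1$ the string of powers of $2$ is empty, so $\mu_0$ consists only of the odd parts $a_i$), and let $\mu_0'$ be the partition obtained by sorting $[a_1,\dots,a_s,2^t]$ in non-increasing order. Then for every integer $n\ge |\mu_0|$, $$A(\mu_0)(n)=\tfrac12\, B(\mu_0')(n+2).$$
   Context: For a partition $\mu$, $|\mu|$ denotes the sum of its parts. For partitions $\lambda,\mu$ of $N$, $\chi^{\lambda}(\mu)$ denotes the value of the irreducible character of the symmetric group $S_N$ indexed by $\lambda$ on the conjugacy class of permutations of cycle type $\mu$. For a partition $\nu$ with all parts $\ge 2$ and an integer $N\ge|\nu|$, $\nu 1^{N-|\nu|}$ denotes the partition of $N$ obtained by appending $N-|\nu|$ parts equal to $1$ to $\nu$. Define $$A(\nu)(N)=\sum_{j=0}^{\lfloor N/2\rfloor}\chi^{(N-j,j)}(\nu 1^{N-|\nu|})^2$$ (sum over two-rowed shapes, where $(N,0)$ means the one-row shape $(N)$), and $$B(\nu)(N)=\sum_{j=1}^{N}\chi^{(j,1^{N-j})}(\nu 1^{N-|\nu|})^2$$ (sum over hook shapes $(j,1,\dots,1)$ with $N-j$ ones). *)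

(* Defs.v *)
From mathcomp Require Import all_boot all_order all_algebra all_fingroup.
From mathcomp Require Import all_solvable all_field all_character.

Set Implicit Arguments.
Unset Strict Implicit.
Unset Printing Implicit Defensive.

Import GRing.Theory.
Local Open Scope ring_scope.

(* A partition is the non-increasing sequence of its (positive) parts. *)

(* Fixed points are counted: they are orbits of size 1. *)
Definition cycle_type (N : nat) (w : 'S_N) : seq nat :=
  sort geq [seq #|X| | X : {set 'I_N} <- enum (porbits w)].

(* Young subgroups of the tableau of shape la obtained by writing 0, ..., N-1
   row after row: the cell of i is (reshape_index la i, reshape_offset la i). *)
Definition row_stab (N : nat) (la : seq nat) : {set 'S_N} :=
  [set w : 'S_N |
    [forall i : 'I_N, reshape_index la (w i) == reshape_index la i]].

Definition col_stab (N : nat) (la : seq nat) : {set 'S_N} :=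
  [set w : 'S_N |
    [forall i : 'I_N, reshape_offset la (w i) == reshape_offset la i]].

(* The Young symmetrizer, as an element of the group algebra C[S_N]; here
   gring_row (regular_repr g) is the basis vector of g. *)
Definition young_symmetrizer (N : nat) (la : seq nat) :
    'rV[algC]_#|[set: 'S_N]%G| :=
  let aG := regular_repr algC [set: 'S_N]%G in
  gring_row ((\sum_(g in row_stab N la) aG g) *m
             (\sum_(h in col_stab N la) (-1) ^+ odd_perm h *: aG h)).

(* The Specht module is the right ideal generated by the Young symmetrizer.
   Since (g * h) i = h (g i) for permutations, right ideals here are left
   ideals, and row-times-column here is column-times-row, for the opposite
   composition convention. *)
Definition specht_char (N : nat) (la : seq nat) : 'CF([set: 'S_N]) :=
  cfRepr (submod_repr
    (cyclic_mx_module (regular_repr algC [set: 'S_N]%G)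
                      (young_symmetrizer N la))).

(* chi N la mu is meaningful when la and mu are partitions of N; permutations
   of cycle type mu then exist and form a single conjugacy class, so neither
   the choice of w nor the default value matters. *)
Definition chi (N : nat) (la mu : seq nat) : algC :=
  if [pick w : 'S_N | cycle_type w == mu] is Some w
  then specht_char N la w else 0.

Definition pad1 (nu : seq nat) (N : nat) : seq nat :=
  nu ++ nseq (N - sumn nu) 1%N.

(* The shape (N - j, j); zero parts are dropped, so that j = 0 gives (N). *)
Definition two_row (N j : nat) : seq nat :=
  [seq p <- [:: (N - j)%N; j] | (0 < p)%N].

Definition hook (N j : nat) : seq nat := j :: nseq (N - j) 1%N.

Definition A (nu : seq nat) (N : nat) : algC :=
  \sum_(0 <= j < N./2.+1) chi N (two_row N j) (pad1 nu N) ^+ 2.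

Definition B (nu : seq nat) (N : nat) : algC :=
  \sum_(1 <= j < N.+1) chi N (hook N j) (pad1 nu N) ^+ 2.

Definition mu0 (a : seq nat) (t : nat) : seq nat :=
  sort geq (a ++ [seq (2 ^ i)%N | i <- iota 1 t.-1]).

Definition mu0' (a : seq nat) (t : nat) : seq nat :=
  sort geq (rcons a (2 ^ t)%N).

(* Main.v *)
Require Import Defs.
From mathcomp Require Import all_boot all_order all_algebra all_field.
From mathcomp Require Import all_fingroup all_solvable all_character.
From mathcomp Require Import zify ring.

(** Summing [sgn(w|_A)^eps] over the [k]-subsets [A] stable under [w] gives a
    character [X_k] of [S_N]: the action on [k]-subsets when [eps] is false, the
    [k]-th exterior power of the permutation module when [eps] is true. Counting
    orbits on pairs of subsets yields the inner products of the [X_k], whence the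
    irreducibility of [X_j - X_(j-1)] ([eps] false, [2j <= N]) and of
    [X_k - X_(k-1) + X_(k-2) - ...] ([eps] true, [k < N]). The Specht module of
    shape [(N-j,j)] or [(N-k,1^k)] has its constituents in [X_j], resp. [X_k],
    and none in [X_(j-1)], resp. [X_(k-1)], which the column antisymmetrizer
    kills; so it affords that irreducible character.
    Since [sum_k X_k q^k] is the product of [1 + q^m], resp. [1 - (-q)^m], over
    the cycle lengths [m], both sides of the theorem are sums of squared
    coefficients of
      [(1-q) prod_m (1+q^m) = prod_m' (1-(-q)^m') / (1+q)],
    where [m], resp. [m'], runs over the parts of the padded [mu0], resp. [mu0'].
    This polynomial of degree [n+1] has antisymmetric coefficients, and the
    left-hand side sees one half. *)

Set Implicit Arguments.
Unset Strict Implicit.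
Unset Printing Implicit Defensive.
Import Order.TTheory GRing.Theory Num.Theory GroupScope.
Local Open Scope ring_scope.

(** * Characters of cyclic modules in the regular representation *)

(** In the rank factorization [E = C *m R], cancelling the full-rank factors in [C R C R = C R]
    leaves [R *m C = 1%:M]. *)
Lemma mxtrace_idempotent (F : fieldType) n (E : 'M[F]_n) :
  E *m E = E -> \tr E = (\rank E)%:R.
Proof.
move=> EE; set C := col_base E; set R := row_base E.
suffices RC : R *m C = 1%:M.
  by rewrite -{1}(mulmx_base E) mxtrace_mulC RC mxtrace1.
apply: (row_full_inj (col_base_full E)); rewrite -/C.
apply: (row_free_inj (row_base_free E)); rewrite -/R mulmx1.
by rewrite -2!mulmxA mulmxA mulmx_base EE.
Qed.

Section CyclicModule.
Variables (gT : finGroupType) (G : {group gT}).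
Local Notation aG := (regular_repr algC G).
Local Notation nG := #|G|.

(** An endomorphism commuting with the right translations is left multiplication by the image of 1,
    which is [gring_row P]. *)
Lemma mul_gring_mx (P : 'M[algC]_nG) (x : 'rV_nG) :
  (forall g, g \in G -> P *m aG g = aG g *m P) ->
  x *m P = gring_row P *m gring_mx aG x.
Proof.
move=> cP; rewrite -{1}(gring_mxK x) -!gring_row_mul; congr (gring_row _).
rewrite /gring_mx /= [x *m _]mulmx_sum_row !linear_sum /= mulmx_suml.
apply: eq_bigr => i _; rewrite !linearZ /= rowK mxvecK -scalemxAl.
by rewrite cP ?enum_valP.
Qed.

(** With [p] for [gring_row P], the trace of x -> p x g counts, for each [y] in the support of [p],
    the [h] with y h g = h. This is a centraliser order if [y] is conjugate to [g^-1] and 0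
    otherwise; second orthogonality turns it into characters. *)
Lemma mxtrace_regular_twist (P : 'M[algC]_nG) g :
    (forall g, g \in G -> P *m aG g = aG g *m P) -> g \in G ->
  \tr (P *m aG g) = \sum_i \tr (gring_mx 'Chi_i (gring_row P)) * 'chi[G]_i g.
Proof.
move=> cP Gg; set p := gring_row P.
transitivity (\sum_(i < #|G|) p 0 i * \sum_j ('chi[G]_j (enum_val i)) * 'chi_j g); last first.
  under eq_bigr do rewrite mulr_sumr.
  rewrite exchange_big; apply: eq_bigr => j _ /=.
  rewrite /gring_mx /= mulmx_sum_row !linear_sum mulr_suml; apply: eq_bigr => i _.
  by rewrite !linearZ /= rowK mxvecK -mulrA -irrRepr cfunE enum_valP mulr1n.
rewrite /mxtrace.
transitivity (\sum_(h < #|G|) \sum_(i < #|G|) p 0 i *+ (enum_val i * (enum_val h * g) == enum_val h :> gT)%g).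
  apply: eq_bigr => h _.
  have rowP : p *m aG (enum_val h) = row h P.
    rewrite -gring_row_mul cP ?enum_valP // gring_row_mul [gring_row _]rowK.
    by rewrite gring_indexK // mul1g gring_valK -rowE.
  have -> : (P *m aG g) h h = (p *m aG (enum_val h * g)%g) 0 h.
    by rewrite repr_mxM ?enum_valP // mulmxA rowP -row_mul [RHS]mxE.
  rewrite mxE; apply: eq_bigr => i _; rewrite -mulr_natr; congr (_ * _).
  rewrite [LHS]mxE [LHS]mxE eqxx /=; congr (_%:R).
  by rewrite eq_sym -(inj_eq enum_val_inj) gring_indexK // !groupM ?enum_valP.
rewrite exchange_big; apply: eq_bigr => i _ /=.
under eq_bigr do rewrite -mulr_natr.
rewrite -mulr_sumr; congr (_ * _); have Gi := enum_valP i; set x := enum_val i in Gi *.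
under [RHS]eq_bigr => j _ do rewrite -['chi_j g]conjCK -irr_inv.
rewrite second_orthogonality_relation ?groupV //.
rewrite -natr_sum -mulrnA; congr _%:R.
transitivity (\sum_(h in G) ((x * (h * g))%g == h))%N.
  by rewrite [RHS]big_enum_val.
rewrite (eq_bigr (fun h => if (x * (h * g) == h)%g then 1%N else 0%N)); last first.
  by move=> h _; case: ifP.
rewrite -big_mkcondr sum1dep_card.
case: imsetP => [[y Gy xgy] | nog].
  (* For [x = g^-1 ^ y], the solutions [h] of x h g = h form the coset ['C_G[x] :* y^-1]. *)
  rewrite muln1 -[RHS](card_rcoset _ y^-1%g); congr #|pred_of_set _|; apply/setP=> h.
  rewrite mem_rcoset invgK in_setI groupMr // inE.
  have [Gh /= | //] := boolP (h \in G).
  have hyx : (h * y * x = h * g^-1 * y)%g by rewrite xgy conjgE !mulgA mulgK.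
  rewrite mulgA; apply/eqP/cent1P => [xh | cxh].
    by rewrite /commute hyx mulgA -[in LHS]xh mulgK.
  by move: cxh; rewrite /commute hyx mulgA => /mulIg <-; rewrite mulgKV.
rewrite muln0; apply/eqP; rewrite (_ : [set h | _] = set0) ?cards0 //.
apply/setP => h; rewrite !inE; apply/andP => -[Gh /eqP xh]; case: nog.
exists h^-1%g; rewrite ?groupV // conjgE invgK mulgA; apply: (mulIg h).
by rewrite mulgKV; apply: (mulIg g); rewrite mulgKV -mulgA.
Qed.

(* By Maschke the module is the image of an idempotent commuting with G, that is
   of left multiplication by an idempotent f of the group algebra with f u = u. *)
Lemma cyclic_module_char (u : 'rV[algC]_nG) :
  cfRepr (submod_repr (cyclic_mx_module aG u)) =
  \sum_i (\rank (gring_mx 'Chi_i u))%:R *: 'chi[G]_i.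
Proof.
set modU := cyclic_mx_module aG u; set U := cyclic_mx aG u in modU *.
have [|V modV defUV dxUV] := mx_Maschke_pchar aG _ modU (submx1 U).
  exact: algC'G_pchar.
have {}dxUV := mxdirect_addsP dxUV; pose P := proj_mx U V; have PP : P *m P = P by apply: proj_mx_proj.
have cP g : g \in G -> P *m aG g = aG g *m P.
  move=> Gg; apply/esym; rewrite -[LHS]mul1mx mulmxA.
  rewrite (hom_mxP (_ : (1%:M <= dom_hom_mx aG P)%MS)) //; first by rewrite mul1mx.
  by rewrite -defUV; apply: proj_mx_hom.
have uP : u *m P = u.
  by rewrite proj_mx_id ?cyclic_mx_id.
pose f := gring_row P.
have ff (i : Iirr G) : gring_mx 'Chi_i f *m gring_mx 'Chi_i f = gring_mx 'Chi_i f.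
  by rewrite -gring_mxA -mul_gring_mx //= -gring_row_mul PP.
(* [f] is a right multiple of [u], and u = f u, so each rank bounds the other. *)
have rk (i : Iirr G) : \rank (gring_mx 'Chi_i f) = \rank (gring_mx 'Chi_i u).
  apply/eqP; rewrite eqn_leq; apply/andP; split.
    have : (f <= U)%MS by rewrite /f -[P]mul1mx gring_row_mul proj_mx_sub.
    case/cyclic_mxP => A RA ->; rewrite -[A]gring_rowK // gring_mxA.
    exact: mxrankM_maxl.
  by rewrite -{1}uP mul_gring_mx // gring_mxA; apply: mxrankM_maxl.
apply/cfun_inP => g Gg; rewrite cfunE Gg mulr1n sum_cfunE.
transitivity (\tr (P *m aG g)).
  have PU : (P <= U)%MS by rewrite -[P]mul1mx proj_mx_sub.
  (* [V1] embeds [U] and [I1] takes coordinates in it; factoring [P] through them and cycling the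
     trace identifies it with the trace on [U]. *)
  pose V1 : 'M_(\rank U, _) := val_submod 1%:M; pose I1 := in_submod U 1%:M.
  have VP : V1 *m P = V1 by rewrite proj_mx_id // val_submodP.
  have defP : P = P *m I1 *m V1.
    by rewrite -in_submodE -val_submodE in_submodK.
  transitivity (\tr (in_submod U (V1 *m aG g))) => //.
  rewrite in_submodE -/I1 [in RHS]defP -[in RHS](mulmxA (P *m I1)).
  rewrite [RHS]mxtrace_mulC (mulmxA (V1 *m aG g) P).
  by rewrite -(mulmxA V1 (aG g) P) -cP // (mulmxA V1 P) VP.
rewrite mxtrace_regular_twist //; apply: eq_bigr => i _.
by rewrite cfunE -/f mxtrace_idempotent // rk.
Qed.
End CyclicModule.

(** * Sums of a linear character over a subgroup *)

Section LinearIdempotent.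
Variables (gT : finGroupType) (G : {group gT}).

(** [S *m S = #|H|%:R *: S], so [S] divided by [#|H|] is idempotent and its trace is its rank. *)
Lemma lin_sum_rank n (rG : mx_representation algC G n) (H : {group gT})
    (theta : gT -> algC) :
    H \subset G -> {in H &, {morph theta : g h / (g * h)%g >-> g * h}} ->
  \sum_(h in H) theta h * \tr (rG h)
    = #|H|%:R * (\rank (\sum_(h in H) theta h *: rG h)%R)%:R.
Proof.
move=> sHG thM; set S := (X in \rank X).
have nzH : #|H|%:R != 0 :> algC by rewrite pnatr_eq0 -lt0n cardG_gt0.
have SS : S *m S = #|H|%:R *: S.
  rewrite {1}/S mulmx_suml -sum1_card natr_sum scaler_suml.
  apply: eq_bigr => h Hh; rewrite scale1r -scalemxAl /S mulmx_sumr scaler_sumr.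
  rewrite [RHS](reindex_inj (mulgI h)) /=; apply: eq_big => g.
    by rewrite groupMl.
  move=> Hg; rewrite -scalemxAr scalerA thM // repr_mxM //; exact: (subsetP sHG).
pose E := #|H|%:R^-1 *: S.
have EE : E *m E = E.
  by rewrite -scalemxAl -scalemxAr SS [_ *: (_ *: S)]scalerA mulVf // scale1r.
have := mxtrace_idempotent EE; rewrite mxrank_scale_nz ?invr_eq0 // => <- .
by rewrite linearZ /= mulVKf // linear_sum; apply: eq_bigr => h _; rewrite linearZ.
Qed.

(** Each irreducible contributes its multiplicity in [phi] times [#|H|] times a rank. These terms
    are non-negative with sum 0, so the rank vanishes wherever the multiplicity does not. *)
Lemma lin_sum_kills (H : {group gT}) (theta : gT -> algC) (phi : 'CF(G)) i :
    H \subset G -> {in H &, {morph theta : g h / (g * h)%g >-> g * h}} ->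
    phi \is a character -> \sum_(h in H) theta h * phi h = 0 ->
    '['chi_i, phi] != 0 ->
  \sum_(h in H) theta h *: 'Chi_i h = 0.
Proof.
move=> sHG thM Cphi; rewrite {1}[phi]cfun_sum_cfdot.
have nzH : #|H|%:R != 0 :> algC by rewrite pnatr_eq0 -lt0n cardG_gt0.
have chiE j : \sum_(h in H) theta h * 'chi[G]_j h
    = #|H|%:R * (\rank (\sum_(h in H) theta h *: 'Chi_j h)%R)%:R.
  rewrite -lin_sum_rank //; apply: eq_bigr => h Hh.
  by rewrite -irrRepr cfunE (subsetP sHG).
under eq_bigr => h _ do rewrite sum_cfunE mulr_sumr.
rewrite exchange_big /= => /eqP; rewrite psumr_eq0 => [/allP/(_ i)|j _]; last first.
  under eq_bigr do rewrite cfunE mulrCA.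
  rewrite -mulr_sumr chiE; apply: mulr_ge0; last by rewrite mulr_ge0 ?ler0n.
  exact: natr_ge0 (Cnat_cfdot_char_irr j Cphi).

rewrite mem_index_enum => /(_ isT) /=.
under eq_bigr do rewrite cfunE mulrCA.
rewrite -mulr_sumr chiE mulf_eq0 (mulf_eq0 #|H|%:R) (negPf nzH) /= pnatr_eq0 mxrank_eq0.
by rewrite (cfdotC 'chi_i) fmorph_eq0 => /orP[-> //|/eqP-> //].
Qed.
End LinearIdempotent.

(** Orbit-stabiliser: translation by some [g0] carrying [x0] to [x] matches the stabiliser of [x]
    with the elements sending [x0] to [x], and these sets partition [aT]. *)
Lemma sum_card_stab_transitive (aT : finGroupType) (R : finType)
    (f : aT -> R -> R) (O : {pred R}) x0 :
    (forall x, f 1%g x = x) -> (forall g h x, f (g * h)%g x = f h (f g x)) ->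
    (forall g, f g x0 \in O) -> (forall x, x \in O -> exists g, f g x0 = x) ->
  (\sum_(x in O) #|[set w | f w x == x]| = #|aT|)%N.
Proof.
move=> f1 fM fO trO.
transitivity (\sum_(x in O) \sum_(g : aT) (f g x0 == x))%N.
  apply: eq_bigr => x /trO[g0 g0x]; rewrite -sum1dep_card big_mkcond /=.
  rewrite [RHS](reindex_inj (mulgI g0)) /=; apply: eq_bigr => w _.
  by rewrite fM g0x; case: eqP.
rewrite exchange_big /= -sum1_card; apply: eq_bigr => g _.
rewrite (bigD1 (f g x0)) ?fO //= eqxx big1 // => x /andP[_ /negPf].
by rewrite eq_sym => ->.
Qed.

Lemma exists_perm_colour (N : nat) (K : eqType) (f g : 'I_N -> K) :
  (forall c, #|[set x | f x == c]| = #|[set x | g x == c]|) ->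
  exists p : 'S_N, forall x, f x = g (p x).
Proof.
move=> fg.
have /tuple_permP[p eq_p] : perm_eq [tuple f i | i < N] [tuple g i | i < N].
  apply/allP => c _; apply/eqP; rewrite /= !count_map -!sum1_count -enumT !big_enum_cond /=.
  by rewrite !sum1dep_card.
exists p => x; have := congr1 (fun s => nth (f x) s x) eq_p.
by rewrite -!tnth_nth !tnth_mktuple.
Qed.

(** * Stabilisers of subsets and their signs *)

Section SignedSubsets.
Variable N : nat.
Implicit Types (A B : {set 'I_N}) (w g h : 'S_N) (eps : bool).
Local Notation G := [set: 'S_N]%G.
Local Notation stab A := 'N(A | 'P).

Lemma stabsP A w : reflect (forall x, (w x \in A) = (x \in A)) (w \in stab A).
Proof. by apply: (iffP astabsP). Qed.

Lemma stabs_imset A w : (w \in stab A) = (w @: A == A).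
Proof.
apply/stabsP/eqP => [wA | eqA x]; last by rewrite -{1}eqA mem_imset //; apply: perm_inj.
apply/eqP; rewrite eqEcard card_imset ?leqnn ?andbT; last exact: perm_inj.
by apply/subsetP => _ /imsetP[x Ax ->]; rewrite wA.
Qed.

Lemma stabsJ A w g : (w ^ g \in stab (g @: A))%g = (w \in stab A).
Proof.
apply/stabsP/stabsP => wA x; last first.
  rewrite -[x](permKV g) permJ !mem_imset //; exact: perm_inj.
by have := wA (g x); rewrite permJ !mem_imset //; apply: perm_inj.
Qed.

Lemma restr_permJ A w g :
  w \in stab A -> restr_perm (g @: A) (w ^ g)%g = (restr_perm A w ^ g)%g.
Proof.
move=> sAw; apply/permP => x; rewrite -[x](permKV g); move: (g^-1%g x) => {}x.
rewrite permJ; have [Ax | nAx] := boolP (x \in A).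
  by rewrite !restr_permE ?stabsJ ?imset_f ?permJ.
rewrite (out_perm (restr_perm_on _ _)) ?mem_imset //; last exact: perm_inj.
by rewrite (out_perm (restr_perm_on _ _)).
Qed.

(** The switch [eps] lets one development serve two-row shapes ([false], constant value 1) and hooks
    ([true]). *)
Definition sgn_on eps A w : algC := (-1) ^+ (eps && odd_perm (restr_perm A w)).

Lemma sgn_onM eps A : {in stab A &, {morph sgn_on eps A : g h / (g * h)%g >-> g * h}}.
Proof.
move=> g h sg sh; rewrite /sgn_on morphM // odd_permM.
by case: eps => /=; rewrite ?mulr1 // signr_addb.
Qed.

Lemma sgn_on_conj eps A w : (sgn_on eps A w)^* = sgn_on eps A w.
Proof. exact: rmorph_sign. Qed.

Lemma sgn_onJ eps A w g : w \in stab A -> sgn_on eps (g @: A) (w ^ g)%g = sgn_on eps A w.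
Proof. by move=> sAw; rewrite /sgn_on restr_permJ // odd_permJ. Qed.

Lemma tperm_stabs A x y : (x \in A) = (y \in A) -> tperm x y \in stab A.
Proof. by move=> xy; apply/stabsP => z; case: tpermP => [->|->|//]; rewrite xy. Qed.

Lemma sgn_on_tperm eps A x y : x != y -> (x \in A) = (y \in A) ->
  sgn_on eps A (tperm x y) = (-1) ^+ (eps && (x \in A)).
Proof.
move=> nxy xy; rewrite /sgn_on; congr (_ ^+ (_ && _)).
have sA := tperm_stabs xy; have [Ax | nAx] := boolP (x \in A).
  rewrite (_ : restr_perm A _ = tperm x y) ?odd_tperm //; apply/permP => z.
  have [Az | nAz] := boolP (z \in A); first by rewrite restr_permE.
  rewrite (out_perm (restr_perm_on _ _)) //; case: tpermP nAz => // ->; rewrite -?xy ?Ax //.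
rewrite (_ : restr_perm A _ = 1%g) ?odd_perm1 //; apply/permP => z; rewrite perm1.
have [Az | nAz] := boolP (z \in A); last by rewrite (out_perm (restr_perm_on _ _)).
by rewrite restr_permE //; case: tpermP Az => // ->; rewrite -?xy ?(negPf nAx).
Qed.

(** Colour a point by its membership in the two sets: the three cardinalities determine the sizes of
    all four colour classes. *)
Lemma transitive_pairs A B A' B' :
  #|A| = #|A'| -> #|B| = #|B'| -> #|A :&: B| = #|A' :&: B'| ->
  exists p : 'S_N, (p @: A, p @: B) = (A', B').
Proof.
move=> cA cB cAB.
have [|p pP] := @exists_perm_colour N _ (fun x => (x \in A, x \in B))
                                       (fun x => (x \in A', x \in B')).
  have colE (X Y : {set 'I_N}) (c : bool * bool) : [set x | (x \in X, x \in Y) == c]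
      = (if c.1 then X else ~: X) :&: (if c.2 then Y else ~: Y) :> {set 'I_N}.
    apply/setP => x; case: c => [[] []];
      by rewrite !inE xpair_eqE ?eqb_id ?eqbF_neg.
  have cD (X Y : {set 'I_N}) : #|X :&: ~: Y| = (#|X| - #|X :&: Y|)%N by rewrite -setDE cardsD.
  case=> [[] []]; rewrite !colE /=; first exact: cAB.
  - by rewrite !cD cA cAB.
  - by rewrite ![~: _ :&: _]setIC !cD (setIC B) (setIC B') cAB cB.
  rewrite -!setCU; apply/eqP; rewrite -(eqn_add2l #|A :|: B|) cardsC.
  by rewrite cardsU cA cB cAB -cardsU cardsC.
have eqp (X X' : {set 'I_N}) : (forall x, (x \in X) = (p x \in X')) -> p @: X = X'.
  move=> XX'; apply/setP => y; rewrite -[y](permKV p) mem_imset ?XX' //.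
  exact: perm_inj.
by exists p; congr (_, _); apply: eqp => x; case: (pP x).
Qed.

Definition initial_segment b : {set 'I_N} := [set x : 'I_N | (x < b)%N].

Lemma card_initial_segment b : (b <= N)%N -> #|initial_segment b| = b.
Proof.
move=> leb; rewrite -sum1dep_card (big_ord_narrow leb) /= sum1_card card_ord //.
Qed.

End SignedSubsets.

(** * Characters of signed subsets *)

Section SubsetChar.
Variable N : nat.
Implicit Types (A B : {set 'I_N}) (w g h : 'S_N) (eps : bool).
Local Notation G := [set: 'S_N]%G.
Local Notation stab A := 'N(A | 'P).

Lemma subset_char_subproof eps k : is_class_fun <<[set: 'S_N]>>%g
  [ffun w => \sum_(A : {set 'I_N} | (#|A| == k) && (w \in stab A)) sgn_on eps A w].
Proof.
rewrite genGid; apply: intro_class_fun => [w g _ _ | w]; last by rewrite inE.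
rewrite (reindex_inj (imset_inj (@perm_inj _ g))) /=; apply: eq_big => A.
  by rewrite stabsJ card_imset //; apply: perm_inj.
by rewrite stabsJ => /andP[_ sAw]; rewrite sgn_onJ.
Qed.

Definition subset_char eps k : 'CF(G) := Cfun 0 (subset_char_subproof eps k).

Lemma subset_charE eps k w : subset_char eps k w
  = \sum_(A : {set 'I_N} | (#|A| == k) && (w \in stab A)) sgn_on eps A w.
Proof. exact: cfunE. Qed.

Lemma subset_char_conj eps k w : (subset_char eps k w)^* = subset_char eps k w.
Proof.
by rewrite subset_charE rmorph_sum; apply: eq_bigr => A _; rewrite /= sgn_on_conj.
Qed.

Definition pairs_over k l i : {set {set 'I_N} * {set 'I_N}} :=
  [set p : {set 'I_N} * {set 'I_N} | [&& #|p.1| == k, #|p.2| == l & #|p.1 :&: p.2| == i]].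

(** By [transitive_pairs] these pairs form a single orbit; [p0] certifies that it is non-empty. *)
Lemma sum_stab_pairs k l i p0 : p0 \in pairs_over k l i ->
  (\sum_(p in pairs_over k l i) #|stab p.1 :&: stab p.2| = #|G|)%N.
Proof.
case: p0 => A B; rewrite inE /= => /and3P[/eqP cA /eqP cB /eqP cAB].
rewrite [in RHS]cardsT.
pose f (g : 'S_N) (p : {set 'I_N} * {set 'I_N}) := (g @: p.1, g @: p.2).
have injg (g : 'S_N) : injective g by apply: perm_inj.
rewrite -(@sum_card_stab_transitive _ _ f (mem (pairs_over k l i)) (A, B)) /=.
- apply: eq_bigr => -[A1 B1] _ /=; apply: eq_card => w.
  by rewrite in_setI !stabs_imset inE xpair_eqE.
- case=> A1 B1; rewrite /f /=; congr (_, _);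
    by under eq_imset => x do rewrite perm1; rewrite imset_id.
- move=> g h [A1 B1]; rewrite /f /=; congr (_, _); rewrite -imset_comp;
    by apply: eq_imset => x; rewrite /= permM.
- by move=> g; rewrite !inE /= -imsetI ?card_imset ?cA ?cB ?cAB ?eqxx // => x y _ _; apply: injg.
case=> A1 B1; rewrite inE /= => /and3P[/eqP c1 /eqP c2 /eqP c12].
have [||| g <-] := @transitive_pairs _ A B A1 B1; rewrite ?cA ?cB ?cAB //.
by exists g.
Qed.

(** The first three conditions say that a [k]-set and an [l]-set with [i] common points exist; the
    last says that signs do not cancel on the stabiliser of such a pair. *)
Definition valid_overlap eps k l i :=
  [&& (i <= k)%N, (i <= l)%N, (k + l <= N + i)%N &
      eps ==> (k <= i.+1)%N && (l <= i.+1)%N].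

Lemma pairs_over_nonempty k l i :
  (exists p, p \in pairs_over k l i) <-> [&& (i <= k)%N, (i <= l)%N & (k + l <= N + i)%N].
Proof.
split=> [[[A B]]|/and3P[ik il kl]].
  rewrite inE /= => /and3P[/eqP <- /eqP <- /eqP <-].
  rewrite !subset_leq_card ?subsetIl ?subsetIr //=.
  by rewrite (addnC N) -leq_subLR -cardsU -[N in (_ <= N)%N]card_ord max_card.
(* The witnesses are the intervals [0, k) and [k - i, k - i + l), which share [i] points and fit
   below [N]. *)
pose A := initial_segment N k; pose J := initial_segment N (k - i).
pose C := initial_segment N (k - i + l).
have JA : J \subset A by apply/subsetP => x; rewrite !inE; lia.
have JC : J \subset C by apply/subsetP => x; rewrite !inE; lia.
have AC : A \subset C by apply/subsetP => x; rewrite !inE; lia.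
exists (A, C :\: J); rewrite inE /= setIDA (setIidPl AC) !cardsDS //.
by rewrite !card_initial_segment; lia.
Qed.

(* If A :\: B or B :\: A has two elements, their transposition cancels the sum;
   otherwise both signs are that of the restriction to A :&: B. *)
Lemma sum_sgn_stab eps A B :
  \sum_(w in stab A :&: stab B) sgn_on eps A w * sgn_on eps B w
    = (#|stab A :&: stab B| *
       (eps ==> (#|A| <= #|A :&: B|.+1)%N && (#|B| <= #|A :&: B|.+1)%N))%:R.
Proof.
have sgB x : sgn_on false x =1 fun=> 1 by move=> w; rewrite /sgn_on expr0.
case: eps => /=; last first.
  by rewrite muln1 -sum1_card natr_sum; apply: eq_bigr => w _; rewrite !sgB mulr1.
have bad x y : x != y -> (x \in A) = (y \in A) -> (x \in B) = (y \in B) ->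
    (x \in A) != (x \in B) ->
  \sum_(w in stab A :&: stab B) sgn_on true A w * sgn_on true B w = 0.
  move=> nxy xyA xyB AB; apply/eqP; rewrite -eqNr; apply/eqP.
  rewrite [RHS](reindex_inj (mulgI (tperm x y))) -sumrN.
  have [sA sB] := (tperm_stabs xyA, tperm_stabs xyB).
  apply: eq_big => w; first by rewrite [LHS]in_setI [RHS]in_setI !groupMl.
  rewrite in_setI => /andP[sAw sBw].
  rewrite !sgn_onM // !sgn_on_tperm // mulrACA /=.
  by case: (x \in A) (x \in B) AB => [] [] //= _; rewrite ?expr0 ?expr1 ?mulr1 ?mul1r mulN1r.
have two (X Y : {set 'I_N}) : ~~ (#|X| <= #|X :&: Y|.+1)%N ->
    exists x y, [/\ x != y, x \in X :\: Y & y \in X :\: Y].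
  rewrite -ltnNge => XY; have : (1 < #|X :\: Y|)%N by rewrite cardsD; lia.
  by case/card_gt1P => x [y [xX yX nxy]]; exists x, y.
have [cA | /two[x [y [nxy]]]] := boolP (#|A| <= #|A :&: B|.+1)%N; last first.
  rewrite !inE => /andP[/negPf xB xA] /andP[/negPf yB yA] /=.
  by rewrite muln0 (bad x y) ?xA ?yA ?xB ?yB.
have [cB | cB] := boolP (#|B| <= #|B :&: A|.+1)%N; last first.
  have [x [y [nxy]]] := two _ _ cB.
  rewrite !inE => /andP[/negPf xB xA] /andP[/negPf yB yA] /=.
  by rewrite (setIC A) (negPf cB) muln0 (bad x y) ?xA ?yA ?xB ?yB.
(* At most one point of [X] lies off [Y], so [w] fixes it and it does not affect the restriction. *)
have red (X Y : {set 'I_N}) w : (#|X| <= #|X :&: Y|.+1)%N -> w \in stab X -> w \in stab Y ->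
    restr_perm X w = restr_perm (X :&: Y) w.
  move=> cX sX sY; apply/permP => x.
  have sXY : w \in stab (X :&: Y).
    by apply/stabsP => z; rewrite !inE (stabsP _ _ sX) (stabsP _ _ sY).
  have [xXY | nXY] := boolP (x \in X :&: Y).
    by rewrite !restr_permE //; case/setIP: xXY.
  rewrite [RHS](out_perm (restr_perm_on _ _)) //.
  have [xX | nX] := boolP (x \in X); last by rewrite (out_perm (restr_perm_on _ _)).
  have xD : x \in X :\: Y by rewrite inE xX andbT; move: nXY; rewrite inE xX.
  have wxD : w x \in X :\: Y.
    by rewrite inE (stabsP _ _ sX) (stabsP _ _ sY) -in_setD.
  rewrite restr_permE //; apply/eqP; apply: contraTT cX => wx; rewrite -ltnNge.
  rewrite -(cardsID Y X); suff : (1 < #|X :\: Y|)%N by lia.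
  by apply/card_gt1P; exists x, (w x); split; rewrite // eq_sym.
rewrite -(setIC B) cB muln1 -sum1_card natr_sum; apply: eq_bigr => w.
rewrite in_setI => /andP[sA sB].
by rewrite /sgn_on (red A B) // (red B A) // setIC -signr_addb addbb.
Qed.

(** Times [#|G|], the inner product is a sum over pairs of subsets and their common stabilisers. The
    orbits of pairs are indexed by the overlap [i], and each contributes [#|G|] or 0. *)
Lemma cfdot_subset_char eps k l :
  '[subset_char eps k, subset_char eps l]
    = (\sum_(i < N.+1) valid_overlap eps k l i)%:R.
Proof.
have nzG : #|G|%:R != 0 :> algC by rewrite pnatr_eq0 -lt0n cardG_gt0.
apply: (mulfI nzG); rewrite cfdotE mulVKf //.
transitivity (\sum_(p : {set 'I_N} * {set 'I_N} | (#|p.1| == k) && (#|p.2| == l))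
   \sum_(w in stab p.1 :&: stab p.2) sgn_on eps p.1 w * sgn_on eps p.2 w).
  rewrite (exchange_big_dep predT) //= big_mkcond [LHS]big_mkcond /=.
  apply: eq_bigr => w _; rewrite inE subset_char_conj !subset_charE big_distrlr /=.
  rewrite pair_big /=; apply: eq_bigl => p.
  by rewrite [in RHS]in_setI andbACA.
under eq_bigr do rewrite sum_sgn_stab.
rewrite -natr_sum -natrM big_distrr /=; congr _%:R.
rewrite (partition_big (fun p => inord #|p.1 :&: p.2| : 'I_N.+1) predT) //=.
apply: eq_bigr => i _.
have inP (p : {set 'I_N} * {set 'I_N}) : [&& #|p.1| == k, #|p.2| == l & inord #|p.1 :&: p.2| == i]
    = (p \in pairs_over k l i).
  rewrite inE; do 2!congr (_ && _); rewrite -val_eqE /= inordK // ltnS.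
  by rewrite -[N in (_ <= N)%N]card_ord max_card.
transitivity (\sum_(p in pairs_over k l i) #|stab p.1 :&: stab p.2| *
     (eps ==> (k <= i.+1)%N && (l <= i.+1)%N))%N.
  apply: eq_big => p; first by rewrite -andbA inP.
  by rewrite -andbA inP inE => /and3P[/eqP-> /eqP-> /eqP->].
rewrite -big_distrl /= /valid_overlap.
case valid: [&& (i <= k)%N, (i <= l)%N & (k + l <= N + i)%N].
  have [p0 /sum_stab_pairs->] := (pairs_over_nonempty k l i).2 valid.
  by case/and3P: valid => -> -> ->.
rewrite big_pred0 => [|p]; last first.
  apply: contraFF valid => ne; apply/pairs_over_nonempty; by exists p.
by rewrite mul0n andbA andbA -(andbA (i <= k)%N) valid muln0.
Qed.
End SubsetChar.

(** * Specht modules *)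

Section SpechtCriterion.
Variable N : nat.
Implicit Types (A B : {set 'I_N}) (w g h : 'S_N) (eps : bool).
Local Notation G := [set: 'S_N]%G.
Local Notation stab A := 'N(A | 'P).

Lemma card_stabs_eq A B : #|A| = #|B| -> exists g : 'S_N, g @: A = B.
Proof.
move=> cAB; have [||| g [<- _]] := @transitive_pairs N A A B B; rewrite ?setIid //.
by exists g.
Qed.

(** Frobenius reciprocity: [subset_char] is induced from the linear character [sgn_on eps A0] of the
    stabiliser of [A0], and the sum is an unnormalised projector. Conjugation makes every [A]
    contribute as [A0] does. *)
Lemma cfdot_irr_subset_char eps A0 (i : Iirr G) :
  '['chi_i, subset_char N eps #|A0|] =
  (\rank (\sum_(h in stab A0) sgn_on eps A0 h *: 'Chi_i h)%R)%:R.
Proof.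
set r := \rank _; have nzG : #|G|%:R != 0 :> algC by rewrite pnatr_eq0 -lt0n cardG_gt0.
apply: (mulfI nzG); rewrite cfdotE mulVKf //.
transitivity (\sum_(A : {set 'I_N} | #|A| == #|A0|)
   \sum_(w in stab A) sgn_on eps A w * 'chi_i w).
  rewrite (exchange_big_dep predT) //= big_mkcond [LHS]big_mkcond /=.
  apply: eq_bigr => w _; rewrite inE subset_char_conj subset_charE mulrC mulr_suml.
  by apply: eq_bigl.
transitivity (\sum_(A : {set 'I_N} | #|A| == #|A0|) (#|stab A|%:R * r%:R : algC)).
  apply: eq_bigr => A /eqP/esym/card_stabs_eq[g <-].
  rewrite (reindex_inj (conjg_inj g)) /=.
  rewrite (eq_bigl (mem (stab A0))) => [|w]; last by rewrite stabsJ.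
  rewrite (eq_bigr (fun w => sgn_on eps A0 w * \tr ('Chi_i w))) => [|w sw]; last first.
    by rewrite sgn_onJ // cfunJ ?inE // -irrRepr cfunE inE.
  rewrite lin_sum_rank ?subsetT //; last exact: sgn_onM.
  congr (_%:R * _); rewrite -(cardJg _ g); apply: eq_card => w.
  by rewrite mem_conjg -(stabsJ _ _ g) conjgKV.
rewrite -mulr_suml -natr_sum; congr (_%:R * _).
rewrite [RHS]cardsT -(@sum_card_stab_transitive _ _ (fun g (A : {set 'I_N}) => g @: A)
   [pred A : {set 'I_N} | #|A| == #|A0|] A0) /=.
- by apply: eq_bigr => A _; apply: eq_card => w; rewrite stabs_imset inE.
- by move=> A; under eq_imset => x do rewrite perm1; rewrite imset_id.
- by move=> g h A; rewrite -imset_comp; apply: eq_imset => x; rewrite /= permM.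
- by move=> g; rewrite inE card_imset //; apply: perm_inj.
by move=> A /eqP/esym/card_stabs_eq.
Qed.

(** Its multiplicities are ranks, hence natural numbers; for [k > N] the function is 0. *)
Lemma subset_char_char eps k : subset_char N eps k \is a character.
Proof.
have [kN | Nk] := leqP k N.
  rewrite [subset_char _ _ _]cfun_sum_cfdot rpred_sum // => i _.
  rewrite -(card_initial_segment kN) cfdotC cfdot_irr_subset_char conjC_nat.
  by rewrite scaler_nat rpredMn // irr_char.
rewrite (_ : subset_char N eps k = 0) ?cfun0_char //; apply/cfunP => w.
rewrite subset_charE cfunE big_pred0 // => A; apply/negbTE.
by apply: contraL Nk => /andP[/eqP <- _]; rewrite -leqNgt -[N in (_ <= N)%N]card_ord max_card.
Qed.

(** The transposition preserves [A] and [sgn_on] but changes the outer sign, so the sum attached to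
    [A] is its own opposite. *)
Lemma sum_sgn_subset_char eps m (D : {group 'S_N}) :
    (forall A, #|A| = m -> exists x y,
       [/\ x != y, x \notin A, y \notin A & tperm x y \in D]) ->
  \sum_(c in D) (-1) ^+ odd_perm c * subset_char N eps m c = 0.
Proof.
move=> Dm.
transitivity (\sum_(A : {set 'I_N} | #|A| == m)
   \sum_(c in D :&: stab A) (-1) ^+ odd_perm c * sgn_on eps A c).
  rewrite (exchange_big_dep (mem D)) /= => [|A c _]; last by case/setIP.
  apply: eq_bigr => c Dc; rewrite subset_charE mulr_sumr; apply: eq_bigl => A.
  by rewrite [in RHS]in_setI Dc.
apply: big1 => A /eqP/Dm[x [y [nxy nAx nAy Dt]]].
have xy : (x \in A) = (y \in A) by rewrite (negPf nAx) (negPf nAy).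
have sAt := tperm_stabs xy.
apply/eqP; rewrite -eqNr; apply/eqP.
rewrite [RHS](reindex_inj (mulgI (tperm x y))) -sumrN.
apply: eq_big => w; first by rewrite [LHS]in_setI [RHS]in_setI !groupMl.
rewrite in_setI => /andP[Dw sw]; rewrite sgn_onM // sgn_on_tperm // (negPf nAx) andbF.
by rewrite odd_permM odd_tperm nxy mul1r /= signrN mulNr.
Qed.

Lemma gring_mx_young la n (rG : mx_representation algC G n) :
  gring_mx rG (young_symmetrizer N la) =
  (\sum_(g in row_stab N la) rG g) *m
  (\sum_(h in col_stab N la) (-1) ^+ odd_perm h *: rG h).
Proof.
rewrite /young_symmetrizer -gring_opE gring_opM; last first.
  rewrite linear_sum summx_sub // => h _; rewrite linearZ scalemx_sub //.
  by rewrite envelop_mx_id ?inE.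
congr (_ *m _); rewrite linear_sum; apply: eq_bigr => g _.
  by apply: gring_opG; rewrite inE.
by rewrite linearZ; congr (_ *: _); apply: gring_opG; rewrite inE.
Qed.

(** Its coefficient at the identity is 1: a cell is determined by its row and column, so g h = 1
    with [g] preserving rows and [h] columns forces [g = 1]. *)
Lemma young_symmetrizer_neq0 la : young_symmetrizer N la != 0.
Proof.
have R1 : 1%g \in row_stab N la by rewrite inE; apply/forallP => i; rewrite perm1.
have C1 : 1%g \in col_stab N la by rewrite inE; apply/forallP => i; rewrite perm1.
apply/eqP => /matrixP/(_ 0 (gring_index G 1%g)).
rewrite /young_symmetrizer mulmx_suml linear_sum summxE.
have coef g h : gring_row (regular_repr algC G g *m ((-1) ^+ odd_perm h *: regular_repr algC G h))
     0 (gring_index G 1%g) = (-1) ^+ odd_perm h * (g * h == 1)%g%:R.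
  rewrite -scalemxAr linearZ mxE -repr_mxM ?inE //; congr (_ * _).
  rewrite -[LHS]/(gring_row (regular_repr algC G (g * h)%g) 0 (gring_index G 1%g))
    [gring_row _]rowK mxE eqxx gring_indexK // mul1g eq_sym; congr _%:R.
  by rewrite (inj_in_eq (can_in_inj (gring_indexK (G := G)))) ?inE.
rewrite (bigD1 1%g) //= mulmx_sumr linear_sum summxE (bigD1 1%g) //= coef.
rewrite mul1g eqxx odd_perm1 expr0 mulr1 big1 => [|h /andP[_ /negPf nh]]; last first.
  by rewrite coef mul1g nh mulr0.
rewrite big1 => [|g /andP[Rg /eqP ng]]; last first.
  rewrite mulmx_sumr linear_sum summxE big1 // => h Ch; rewrite coef.
  case: eqP => [gh | _]; last by rewrite mulr0.
  case: ng; apply/permP => i; rewrite perm1; apply: val_inj => /=.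
  rewrite -[RHS](reshape_indexK la) -[LHS](reshape_indexK la).
  move: Rg Ch; rewrite !inE => /forallP/(_ i)/eqP -> /forallP/(_ (g i))/eqP.
  by rewrite -permM gh perm1 => ->.
by rewrite !addr0 mxE => /eqP; rewrite oner_eq0.
Qed.

(* For i != i0, 'Chi_i kills the Young symmetrizer: either 'chi_i is not in the
   subset character, and the absorbed left factor vanishes, or it is in rho, and
   the column antisymmetrizer does. *)
Lemma specht_char_irr la eps A0 (i0 : Iirr G) (D : {group 'S_N}) (phi rho : 'CF(G)) :
    D = col_stab N la :> {set 'S_N} ->
    (forall h n (rG : mx_representation algC G n), h \in stab A0 ->
       sgn_on eps A0 h *: rG h *m gring_mx rG (young_symmetrizer N la)
         = gring_mx rG (young_symmetrizer N la)) ->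
    subset_char N eps #|A0| = 'chi_i0 + phi -> '['chi_i0, subset_char N eps #|A0|] = 1 ->
    (forall i, '['chi_i, phi] != 0 -> '['chi_i, rho] != 0) ->
    rho \is a character -> \sum_(c in D) (-1) ^+ odd_perm c * rho c = 0 ->
  specht_char N la = 'chi_i0.
Proof.
move=> defD absorb defX X1 phi_rho rhoC rho0.
pose r (i : Iirr G) := \rank (gring_mx 'Chi_i (young_symmetrizer N la)).
have spE : specht_char N la = \sum_i (r i)%:R *: 'chi_i.
  exact: cyclic_module_char.
(* By absorption [S] acts on [y] as a non-zero scalar, so the rank of [y] is at most that of [S]. *)
have rX i : (r i)%:R <= '['chi_i, subset_char N eps #|A0|].
  rewrite cfdot_irr_subset_char ler_nat /r.
  set S := (\sum_(h in _) _)%R; set y := gring_mx _ _.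
  have Sy : S *m y = #|stab A0|%:R *: y.
    rewrite mulmx_suml -sum1_card natr_sum scaler_suml; apply: eq_bigr => h sh.
    by rewrite absorb // scale1r.
  have <- : \rank (S *m y) = \rank y.
    by rewrite Sy mxrank_scale_nz // pnatr_eq0 -lt0n cardG_gt0.
  exact: mxrankM_maxl.
have r0 i : i != i0 -> r i = 0%N.
  move=> ni; have [X0 | nX] := eqVneq '['chi_i, subset_char N eps #|A0|] 0.
    by move: (rX i); rewrite X0 lern0 => /eqP.
  have /phi_rho/(lin_sum_kills (subsetT D) _ rhoC rho0) : '['chi_i, phi] != 0.
    by move: nX; rewrite defX cfdotDr cfdot_irr (negPf ni) add0r.
  rewrite defD /r gring_mx_young => -> => [|g h _ _]; first by rewrite mulmx0 mxrank0.
  by rewrite odd_permM signr_addb.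
have r1 : (r i0 <= 1)%N by move: (rX i0); rewrite X1 lern1.
rewrite spE (bigD1 i0) //= big1 => [|i /r0->]; last by rewrite scale0r.
suff : r i0 != 0%N by case: (r i0) r1 => [|[|]] // _ _; rewrite scale1r addr0.
(* If all ranks were 0 the module would be zero, whereas its generator is not. *)
apply/eqP => r00; have : specht_char N la 1%g = 0.
  by rewrite spE big1 ?cfunE // => i _; have [->|/r0->] := eqVneq i i0; rewrite ?r00 scale0r.
rewrite cfunE group1 repr_mx1 mxtrace1 mulr1n => /eqP.
by rewrite pnatr_eq0 mxrank_eq0 cyclic_mx_eq0 (negPf (young_symmetrizer_neq0 la)).
Qed.
End SpechtCriterion.

(** * Irreducible characters as combinations of subset characters *)

Section Shapes.
Variable N : nat.
Implicit Types (A B : {set 'I_N}) (w g h : 'S_N) (eps : bool).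
Local Notation G := [set: 'S_N]%G.
Local Notation stab A := 'N(A | 'P).
Local Notation X := (subset_char N).

Lemma col_stab_group_set la : group_set (col_stab N la).
Proof.
apply/group_setP; split=> [|g h]; first by rewrite inE; apply/forallP => i; rewrite perm1.
rewrite !inE => /forallP sg /forallP sh; apply/forallP => i.
by rewrite permM (eqP (sh _)) sg.
Qed.
Canonical col_stab_group la := Group (col_stab_group_set la).

Lemma tperm_col_stab la (x y : 'I_N) :
  reshape_offset la x = reshape_offset la y -> tperm x y \in col_stab N la.
Proof.
by move=> xy; rewrite inE; apply/forallP => z; case: tpermP => // ->; rewrite xy.
Qed.

Lemma sum_bool_card (I : finType) (b : pred I) : (\sum_i b i = #|[set i | b i]|)%N.
Proof. by rewrite -sum1dep_card [RHS]big_mkcond; apply: eq_bigr => i _; case: (b i). Qed.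

(** A virtual character of norm 1 is irreducible up to sign, and the positive product with a genuine
    character excludes the minus sign. *)
Lemma irr_of_norm1 (psi chi : 'CF(G)) :
    psi \in 'Z[irr G] -> '[psi] = 1 -> chi \is a character -> '[psi, chi] = 1 ->
  exists i, psi = 'chi_i.
Proof.
move=> Zpsi n1 Cchi psi_chi; have [[] [i psiE]] := vchar_norm1P Zpsi n1; exists i; last first.
  by rewrite psiE expr0 scale1r.
have := natr_ge0 (Cnat_cfdot_char (irr_char i) Cchi).
move: psi_chi; rewrite psiE expr1 scaleN1r cfdotNl => /eqP; rewrite eqr_oppLR => /eqP->.
by rewrite oppr_ge0 ler10.
Qed.

Lemma subset_char_vchar eps k : X eps k \in 'Z[irr G].
Proof. exact/char_vchar/subset_char_char. Qed.

Lemma cfdot_subset_char_plain k l : (l <= k)%N -> (k + l <= N)%N ->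
  '[X false k, X false l] = l.+1%:R.
Proof.
move=> lk klN; rewrite cfdot_subset_char sum_bool_card; congr _%:R.
rewrite -[RHS](@card_initial_segment N.+1); last by lia.
by apply: eq_card => i; rewrite !inE /valid_overlap; lia.
Qed.

(** Only overlaps [k] and k - 1 pass the sign condition. Two [k]-sets with overlap k - 1 span k + 1
    points, whence [k < N]. *)
Lemma cfdot_subset_char_sign k l : (k < N)%N -> (l <= k)%N ->
  '[X true k, X true l] = if l == k then (1 + (0 < k))%:R else (l.+1 == k)%:R.
Proof.
move=> kN lk; rewrite cfdot_subset_char sum_bool_card.
pose inN i : 'I_N.+1 := inord i.
have [lk'|nlk] := eqVneq l k.
  rewrite lk' (_ : [set i | _] = inN k |: (if (0 < k)%N then [set inN k.-1] else set0)).
    rewrite cardsU1; case: (posnP k) => [k0|k0] /=; first by rewrite inE cards0.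
    rewrite inE cards1 -val_eqE /= !inordK; try lia; by congr (_ + _)%:R; case: eqP; lia.
  apply/setP => i; rewrite !inE /valid_overlap -val_eqE /= inordK; last by lia.
  by case: posnP => k0; rewrite !inE -?val_eqE /= ?inordK; lia.
have [lk'|nlk'] := eqVneq l.+1 k.
  rewrite (_ : [set i | _] = [set inN l]) ?cards1 //; apply/setP => i.
  by rewrite !inE /valid_overlap -val_eqE /= inordK; lia.
rewrite (_ : [set i | _] = set0) ?cards0 //; apply/setP => i.
by rewrite !inE /valid_overlap; lia.
Qed.

Definition two_row_char j : 'CF(G) :=
  X false j - (if j is j'.+1 then X false j' else 0).

(** For [j > 0], the product with [X false j] is (j + 1) - j = 1 and the product with the preceding
    character is j - j = 0, so the norm is 1. *)
Lemma two_row_char_irr j : (j.*2 <= N)%N ->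
  [/\ exists i, two_row_char j = 'chi_i, '[two_row_char j, X false j] = 1
    & X false j = two_row_char j + (if j is j'.+1 then X false j' else 0)].
Proof.
rewrite /two_row_char -addnn => jN; rewrite subrK.
have X1 : '[two_row_char j, X false j] = 1.
  rewrite /two_row_char; case: j jN => [|j] jN.
    by rewrite subr0 cfdot_subset_char_plain.
  rewrite cfdotBl (cfdotC (X false j)) !cfdot_subset_char_plain; try lia.
  by rewrite conjC_nat -natrB // subSnn.
split=> //; apply: irr_of_norm1 (X1) => //; last exact: subset_char_char.
  by rewrite /two_row_char; case: j {jN X1} => [|j]; rewrite ?subr0 ?rpredB ?subset_char_vchar.
rewrite -[LHS]/('[two_row_char j, _ - _]) cfdotBr X1 /two_row_char.
case: j jN {X1} => [|j] jN; first by rewrite cfdot0r subr0.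
by rewrite cfdotBl !cfdot_subset_char_plain ?subrr ?subr0; try lia.
Qed.

Fixpoint hook_char k : 'CF(G) :=
  X true k - (if k is k'.+1 then hook_char k' else 0).

Lemma hook_char_vchar k : hook_char k \in 'Z[irr G].
Proof.
elim: k => [|k IHk] /=; rewrite rpredB ?subset_char_vchar //; exact: rpred0.
Qed.

Lemma cfdot_hook_char_far m k : (m < N)%N -> (k.+2 <= m)%N -> '[X true m, hook_char k] = 0.
Proof.
move=> mN; elim: k => [|k IHk] km /=; rewrite cfdotBr ?cfdot0r ?IHk; try lia;
  rewrite cfdot_subset_char_sign ?subr0; try lia;
  (case: eqP => [|_]; [lia | by case: eqP => //; lia]).
Qed.

Lemma cfdot_hook_char_next k : (k.+1 < N)%N -> '[X true k.+1, hook_char k] = 1.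
Proof.
case: k => [|k] kN /=; rewrite cfdotBr ?cfdot0r ?cfdot_hook_char_far //;
  rewrite cfdot_subset_char_sign ?subr0 ?eqxx; try lia; last by case: eqP => //; lia.
by [].
Qed.

(** By induction the norm is 2 - 1 - 1 + 1 and the product with the top subset character is 2 -
    1. *)
Lemma hook_char_irr k : (k < N)%N ->
  [/\ exists i, hook_char k = 'chi_i, '[hook_char k, X true k] = 1
    & X true k = hook_char k + (if k is k'.+1 then hook_char k' else 0)].
Proof.
move=> kN.
have [n1 X1] : '[hook_char k] = 1 /\ '[hook_char k, X true k] = 1.
  elim: k kN => [|k IHk] kN /=.
    by rewrite !subr0 !cfdot_subset_char_sign.
  have [n1 _] := IHk (ltnW kN).
  have XX : '[X true k.+1] = 2 by rewrite cfdot_subset_char_sign ?eqxx.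
  have hX : '[hook_char k, X true k.+1] = 1.
    by rewrite cfdotC cfdot_hook_char_next // conjC1.
  rewrite !cfdotBl !cfdotBr XX hX n1 cfdot_hook_char_next //; split; ring.
split=> //; last by case: k {kN n1 X1} => [|k] /=; rewrite subrK.
exact: irr_of_norm1 (hook_char_vchar k) n1 (subset_char_char _ _ _) X1.
Qed.

End Shapes.

(** * Specht modules of two-row and hook shapes *)

Lemma reshape_index_eq sh i r c : (c < nth 0 sh r)%N -> i = flatten_index sh r c ->
  reshape_index sh i = r.
Proof. by move=> lt_c ->; apply: flatten_indexKl. Qed.

Lemma reshape_offset_eq sh i r c : (c < nth 0 sh r)%N -> i = flatten_index sh r c ->
  reshape_offset sh i = c.
Proof. by move=> lt_c ->; apply: flatten_indexKr. Qed.

Section SpechtShapes.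
Variable N : nat.
Implicit Types (A B : {set 'I_N}) (w g h : 'S_N) (eps : bool).
Local Notation G := [set: 'S_N]%G.
Local Notation stab A := 'N(A | 'P).
Local Notation X := (subset_char N).

Lemma two_rowE j : (0 < j)%N -> (j.*2 <= N)%N -> two_row N j = [:: (N - j)%N; j].
Proof. by move=> j0 jN; rewrite /two_row /= j0 ifT //; lia. Qed.

Lemma two_row_coord j (x : 'I_N) : (j.*2 <= N)%N ->
  reshape_index (two_row N j) x = (N - j <= x)%N /\
  reshape_offset (two_row N j) x = (if x < N - j then x : nat else x - (N - j))%N.
Proof.
move=> jN; have ltx := ltn_ord x.
(* For [j = 0] the zero part is dropped and the shape has a single row. *)
have [j0|j0] := posnP j.
  have -> : two_row N j = [:: N].
    by rewrite j0 /two_row /= subn0 ifT //; apply: leq_trans ltx.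
  rewrite j0 subn0 ltx leqNgt ltx.
  by split; [apply: (@reshape_index_eq _ _ _ x) | apply: (@reshape_offset_eq _ _ 0)];
     rewrite /= ?addn0.
rewrite two_rowE //; case: ltnP => xN.
  by split; [apply: (@reshape_index_eq _ _ _ x) | apply: (@reshape_offset_eq _ _ 0)];
     rewrite /= ?addn0.
by split; [apply: (@reshape_index_eq _ _ _ (x - (N - j))) | apply: (@reshape_offset_eq _ _ 1)];
   rewrite /flatten_index /=; lia.
Qed.

Lemma hook_coord k (x : 'I_N) : (k < N)%N ->
  reshape_index (hook N (N - k)) x = (x.+1 - (N - k))%N /\
  reshape_offset (hook N (N - k)) x = (if x < N - k then x : nat else 0)%N.
Proof.
move=> kN; have ltx := ltn_ord x; rewrite /hook; case: ltnP => xN.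
  have -> : (x.+1 - (N - k) = 0)%N by lia.
  by split; [apply: (@reshape_index_eq _ _ _ x) | apply: (@reshape_offset_eq _ _ 0)];
     rewrite /flatten_index /= ?addn0.
have e : (x : nat) = flatten_index (hook N (N - k)) (x.+1 - (N - k)) 0.
  rewrite /flatten_index subSn //= take_nseq ?sumn_nseq; lia.
split; [apply: (reshape_index_eq _ e) | apply: (reshape_offset_eq _ e)];
  rewrite subSn //= nth_nseq ifT; lia.
Qed.

(** These points fill the second row of [two_row N k], and the leg of [hook N (N - k)]. *)
Definition last_segment k : {set 'I_N} := ~: initial_segment N (N - k).

Lemma in_last_segment k x : (x \in last_segment k) = (N - k <= x)%N.
Proof. by rewrite !inE -leqNgt. Qed.

Lemma card_last_segment k : (k <= N)%N -> #|last_segment k| = k.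
Proof.
move=> kN; have := cardsC (initial_segment N (N - k)).
by rewrite card_ord card_initial_segment ?leq_subr // /last_segment; lia.
Qed.

(** [A0] is the second row: its stabiliser preserves both rows, so the row sum absorbs it. Both
    [phi] and [rho] are the preceding subset character. *)
Lemma specht_two_row j : (j.*2 <= N)%N -> specht_char N (two_row N j) = two_row_char N j.
Proof.
move=> jN; have [[i0 psiE] X1 defX] := two_row_char_irr jN; rewrite psiE in X1 defX *.
have cA : #|last_segment j| = j by apply: card_last_segment; lia.
rewrite -{1 2}cA in X1 defX.
pose Y : 'CF(G) := if j is j'.+1 then X false j' else 0.
apply: (specht_char_irr (D := [group of col_stab N (two_row N j)]) (phi := Y) (rho := Y)
  erefl _ defX X1) => //.
- move=> h n rG sh; rewrite /sgn_on expr0 scale1r gring_mx_young mulmxA; congr (_ *m _).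
  have Rh : h \in row_stab N (two_row N j).
    rewrite inE; apply/forallP => x.
    rewrite (two_row_coord _ jN).1 (two_row_coord _ jN).1.
    by have := stabsP _ _ sh x; rewrite !in_last_segment => ->.
  rewrite mulmx_sumr [RHS](reindex_inj (mulgI h)) /=; apply: eq_big => g.
    rewrite !inE; apply/forallP/forallP => sg x.
      by rewrite permM (eqP (sg _)); move: Rh; rewrite inE => /forallP.
    have := sg (h^-1%g x); rewrite permM permKV => /eqP->; rewrite eq_sym.
    by move: Rh; rewrite inE => /forallP/(_ (h^-1%g x)); rewrite permKV.
  by rewrite repr_mxM ?inE.
- by rewrite /Y; case: (j) => [|j']; [apply: cfun0_char | apply: subset_char_char].
rewrite /Y; case: j jN {i0 psiE X1 defX cA Y} => [|j] jN.
  by rewrite big1 // => c _; rewrite cfunE mulr0.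
apply: sum_sgn_subset_char => A cA.
have inN x : (x < N)%N -> exists y : 'I_N, y = x :> nat by move=> xN; exists (Ordinal xN).
(* [f] sends a point to the top of its column; offsets stay below [N], so the default of [insubd] is
   never taken. *)
pose f (x : 'I_N) : 'I_N := insubd x (reshape_offset (two_row N j.+1) x).
have fE x : f x = reshape_offset (two_row N j.+1) x :> nat.
  rewrite /f insubdK // (two_row_coord _ jN).2; have := ltn_ord x.
  by rewrite -topredE /=; case: ifP => _; lia.
(* Pigeonhole: A is smaller than j.+1, so it misses a two-cell column. *)
have : ~~ (initial_segment N j.+1 \subset f @: A).
  apply/negP => /subset_leq_card; rewrite card_initial_segment; last by lia.
  by rewrite leqNgt ltnS -[X in (_ <= X)%N]cA leq_imset_card.
case/subsetPn => x; rewrite inE => xj nfA.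
have [y yE] : exists y : 'I_N, y = (N - j.+1 + x)%N :> nat by apply: inN; lia.
have fx : reshape_offset (two_row N j.+1) x = x.
  by rewrite (two_row_coord _ jN).2 ifT //; lia.
have fy : reshape_offset (two_row N j.+1) y = x.
  by rewrite (two_row_coord _ jN).2 ifF yE; lia.
exists x, y; split; last by apply: tperm_col_stab; rewrite fx fy.
- by rewrite -val_eqE /= yE; lia.
- by apply: contra nfA => xA; apply/imsetP; exists x => //; apply: val_inj; rewrite /= fE fx.
- by apply: contra nfA => yA; apply/imsetP; exists y => //; apply: val_inj; rewrite /= fE fy.
Qed.

(** [A0] is the leg. An [h] preserving it is a row permutation times its restriction [k'] to the
    leg. The row sum absorbs the former and commutes with [k'], which the column sum absorbs up to
    sign. *)
Lemma specht_hook k : (k < N)%N -> specht_char N (hook N (N - k)) = hook_char N k.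
Proof.
move=> kN; have [[i0 psiE] X1 defX] := hook_char_irr kN; rewrite psiE in X1 defX *.
set la := hook N (N - k); set A0 := last_segment k.
have cA : #|A0| = k by apply: card_last_segment; lia.
rewrite -{1}cA in defX; rewrite -{1}cA in X1.
pose phi : 'CF(G) := if k is k'.+1 then hook_char N k' else 0.
pose rho : 'CF(G) := if k is k'.+1 then X true k' else 0.
(* Each leg row is a single cell, so preserving rows means fixing the leg pointwise. *)
have in_row w : (w \in row_stab N la) = [forall x in A0, w x == x].
  rewrite inE; apply/forallP/forall_inP => fw x.
    move=> xA; have := fw x; rewrite (hook_coord _ kN).1 (hook_coord _ kN).1 -val_eqE /=.
    by move: xA; rewrite in_last_segment; lia.
  rewrite (hook_coord _ kN).1 (hook_coord _ kN).1.
  have [xA|xA] := boolP (x \in A0); first by rewrite (eqP (fw x xA)).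
  suff wxA : w x \notin A0.
    by move: xA wxA; rewrite !in_last_segment; lia.
  apply: contra xA => wxA; have /eqP/perm_inj <- := fw _ wxA; exact: wxA.
apply: (specht_char_irr (D := [group of col_stab N la]) (A0 := A0) (eps := true)
  (phi := phi) (rho := rho) erefl _ defX X1) => //.
- move=> h n rG sh; rewrite gring_mx_young; pose k' := restr_perm A0 h.
  have k'on : perm_on A0 k' by apply: restr_perm_on.
  set cs := (\sum_(c in col_stab _ _) _); set rs := (\sum_(r in row_stab _ _) _).
  have Ck : k' \in col_stab N la.
    rewrite inE; apply/forallP => x; have [xA|xA] := boolP (x \in A0); last by rewrite (out_perm k'on).
    have kxA : k' x \in A0 by rewrite (perm_closed _ k'on).
    rewrite (hook_coord _ kN).2 (hook_coord _ kN).2.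
    by move: xA kxA; rewrite !in_last_segment => xA kxA; rewrite !ifN // -leqNgt.
  have Rhk : (h * k'^-1)%g \in row_stab N la.
    rewrite in_row; apply/forall_inP => x xA; rewrite permM.
    by rewrite -(restr_permE sh xA) permK.
  have kcs : rG k' *m cs = (-1) ^+ odd_perm k' *: cs.
    rewrite mulmx_sumr [in RHS]/cs [in RHS](reindex_inj (mulgI k')) scaler_sumr /=.
    apply: eq_big => c; first by rewrite groupMl.
    move=> Cc; rewrite scalerA -signr_addb -scalemxAr repr_mxM ?inE //.
    by rewrite odd_permM addbA addbb addFb.
  have krs : rG k' *m rs = rs *m rG k'.
    rewrite mulmx_sumr mulmx_suml; apply: eq_bigr => r; rewrite in_row => /forall_inP Rr.
    rewrite -!repr_mxM ?inE //; congr (rG _); apply/permP => x; rewrite !permM.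
    have [xA|xA] := boolP (x \in A0).
      by rewrite (eqP (Rr x xA)) (eqP (Rr _ _)) // (perm_closed _ k'on).
    rewrite (out_perm k'on xA) (out_perm k'on) //.
    by apply: contra xA => rxA; have /eqP/perm_inj <- := Rr _ rxA; exact: rxA.
  have hrs : rG (h * k'^-1)%g *m rs = rs.
    rewrite mulmx_sumr /rs [RHS](reindex_inj (mulgI (h * k'^-1)%g)) /=; apply: eq_big => g.
      move: Rhk; rewrite !in_row => /forall_inP Rhk; apply/forall_inP/forall_inP => sg x xA.
        by rewrite permM (eqP (Rhk _ xA)) sg.
      by have := sg x xA; rewrite permM (eqP (Rhk _ xA)).
    by rewrite [RHS]repr_mxM ?inE.
  rewrite -[h in rG h](mulgKV k' h) repr_mxM ?inE // /sgn_on /= -/k'.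
  rewrite -scalemxAl -mulmxA (mulmxA (rG k')) krs !mulmxA hrs -mulmxA kcs.
  by rewrite -scalemxAr scalerA -signr_addb addbb scale1r.
- move=> i; rewrite /phi /rho; case: k kN {i0 psiE X1 defX la A0 cA phi rho in_row} => [|k] kN //.
  have [[i1 e] X1 _] := hook_char_irr (ltnW kN); rewrite e in X1 *.
  rewrite cfdot_irr; have [-> _ | _] := eqVneq i i1; last by rewrite eqxx.
  by rewrite X1 oner_eq0.
- by rewrite /rho; case: (k) => [|k']; [apply: cfun0_char | apply: subset_char_char].
rewrite /rho; case: k kN @la @A0 {i0 psiE X1 defX cA phi rho in_row} => [|k] kN la A0.
  by rewrite big1 // => c _; rewrite cfunE mulr0.
apply: sum_sgn_subset_char => A cA.
have N0 : (0 < N)%N by apply: leq_trans kN.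
(* [Y] is the first column, corner and leg; it has two more points than [A], hence two points off
   [A]. *)
pose Y := Ordinal N0 |: last_segment k.+1.
have cY : #|Y| = k.+2.
  by rewrite cardsU1 (card_last_segment (ltnW kN)) in_last_segment /=; case: leqP; lia.
have /card_gt1P[x [y [xY yY nxy]]] : (1 < #|Y :\: A|)%N.
  have YA : (#|Y :&: A| <= k)%N by rewrite -cA subset_leq_card ?subsetIr.
  by rewrite cardsD cY; move: YA; lia.
have offY z : z \in Y -> reshape_offset la z = 0%N.
  by rewrite in_setU1 in_last_segment (hook_coord _ kN).2 -val_eqE /=; case: ltnP; lia.
move: xY yY; rewrite !in_setD => /andP[nx xY] /andP[ny yY].
by exists x, y; split=> //; apply: tperm_col_stab; rewrite !offY.
Qed.
End SpechtShapes.

(** * Generating function over the cycles *)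

Section CycleGeneratingFunction.
Variable N : nat.
Implicit Types (A B : {set 'I_N}) (w g h : 'S_N) (eps : bool).
Local Notation G := [set: 'S_N]%G.
Local Notation stab A := 'N(A | 'P).

Definition orbits_in w A := [set porbit w x | x in A].

Lemma stabsX w A i : w \in stab A -> (w ^+ i)%g \in stab A.
Proof. exact: groupX. Qed.

Lemma porbit_sub_stab w A x : w \in stab A -> x \in A -> porbit w x \subset A.
Proof.
move=> sw Ax; apply/subsetP => _ /porbitP[i ->].
by rewrite (stabsP _ _ (stabsX i sw)).
Qed.

Lemma cover_orbits_in w A : w \in stab A -> cover (orbits_in w A) = A.
Proof.
move=> sw; apply/setP => y; apply/bigcupP/idP => [[_ /imsetP[x Ax ->]] | Ay].
  exact/subsetP/porbit_sub_stab.
by exists (porbit w y); [apply: imset_f | apply: porbit_id].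
Qed.

Lemma orbits_in_sub w A : orbits_in w A \subset porbits w.
Proof. by apply/subsetP => _ /imsetP[x _ ->]; apply: imset_f. Qed.

(** Together with [cover_orbits_in], this makes [cover] a bijection from sets of cycles of [w] to
    subsets stable under [w]. *)
Lemma cover_stab w (J : {set {set 'I_N}}) : J \subset porbits w ->
  w \in stab (cover J) /\ orbits_in w (cover J) = J.
Proof.
move=> /subsetP JP.
have mem_cover x : (x \in cover J) = (porbit w x \in J).
  apply/bigcupP/idP => [[Y YJ xY] | xJ]; last by exists (porbit w x); rewrite ?porbit_id.
  have /imsetP[y _ YE] := JP _ YJ; move: xY; rewrite YE -eq_porbit_mem => /eqP->.
  by rewrite -YE.
split; first by apply/stabsP => x; rewrite !mem_cover -(porbit_perm w 1 x) expg1.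
apply/setP => Y; apply/imsetP/idP => [[x xJ ->] | YJ]; first by rewrite -mem_cover.
by have /imsetP[y _ YE] := JP _ YJ; exists y; rewrite // mem_cover -YE.
Qed.

Lemma trivIset_porbits w (J : {set {set 'I_N}}) : J \subset porbits w -> trivIset J.
Proof.
move=> /subsetP JP; apply/trivIsetP => Y Z /JP/imsetP[y _ ->] /JP/imsetP[z _ ->].
apply: contraR => /pred0Pn[x /= /andP[]].
by rewrite -!eq_porbit_mem => /eqP-> /eqP->.
Qed.

Lemma porbit_restr_perm w A x : w \in stab A ->
  porbit (restr_perm A w) x = if x \in A then porbit w x else [set x].
Proof.
move=> sw; have rX i : (restr_perm A w ^+ i)%g = restr_perm A (w ^+ i)%g.
  by rewrite morphX.
apply/setP => y; case: ifP => xA.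
  apply/porbitP/porbitP => -[i ->]; exists i; rewrite rX restr_permE //; exact: stabsX.
rewrite inE; apply/porbitP/eqP => [[i ->] | ->]; last by exists 0%N; rewrite expg0 perm1.
by rewrite rX (out_perm (restr_perm_on _ _)) ?xA.
Qed.

(** The parity of a permutation is that of the number of points plus the number of cycles; points
    off [A] are singleton cycles and cancel. *)
Lemma odd_restr_perm w A : w \in stab A ->
  odd_perm (restr_perm A w) = odd #|A| (+) odd #|orbits_in w A|.
Proof.
move=> sw; rewrite /odd_perm.
have -> : porbits (restr_perm A w) = orbits_in w A :|: [set [set x] | x in ~: A].
  transitivity (porbit (restr_perm A w) @: (A :|: ~: A)).
    by apply/setP => Y; apply/imsetP/imsetP => -[x _ ->]; exists x; rewrite // setUCr inE.
  rewrite imsetU; congr (_ :|: _); apply: eq_in_imset => x.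
    by move=> xA; rewrite porbit_restr_perm // xA.
  by rewrite inE => /negPf xA; rewrite porbit_restr_perm // xA.
rewrite cardsU (_ : _ :&: _ = set0) ?cards0 ?subn0; last first.
  apply/setP => Y; rewrite in_set0; apply/setIP => -[/imsetP[x xA ->] /imsetP[y]].
  rewrite inE => /negP yA /setP/(_ y); rewrite set11 => xy; case: yA.
  by apply: (subsetP (porbit_sub_stab sw xA)).
rewrite [#|[set [set _] | _ in _]|]card_imset; last exact: set1_inj.
rewrite -(cardsC A) !oddD [LHS]addbC -!addbA (addbC (odd #|~: A|)) -!addbA addbb addbF.
by rewrite addbC.
Qed.

Lemma sgn_on_orbits eps w A : w \in stab A ->
  sgn_on eps A w = \prod_(Y in orbits_in w A) (-1) ^+ (eps && ~~ odd #|Y|).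
Proof.
move=> sw; rewrite /sgn_on odd_restr_perm //.
have tI := trivIset_porbits (orbits_in_sub w A).
rewrite -{1}(cover_orbits_in sw) -(eqP tI) -sum1_card -oddD -big_split /=.
case: eps => /=; last by rewrite big1.
rewrite signr_odd -prodrXr; apply: eq_bigr => Y _.
by rewrite addn1 -signr_odd oddS.
Qed.

(** For [eps] true this is 1 - (-q)^m, with q for ['X]. *)
Definition cycle_factor eps m : {poly algC} := 1 + (-1) ^+ (eps && ~~ odd m) *: 'X^m.

(** Expanding the product chooses a set of cycles, that is a stable subset: the exponent is its size
    and the coefficient its sign. *)
Lemma subset_char_coef eps k w :
  subset_char N eps k w = (\prod_(Y in porbits w) cycle_factor eps #|Y|)`_k.
Proof.
(* [F] vanishes off the cycles, so expanding over all families [J] keeps only families of cycles. *)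
pose F Y : {poly algC} :=
  if Y \in porbits w then (-1) ^+ (eps && ~~ odd #|Y|) *: 'X^(#|Y|) else 0.
have -> : \prod_(Y in porbits w) cycle_factor eps #|Y| = \prod_Y (F Y + 1).
  rewrite big_mkcond; apply: eq_bigr => Y _; rewrite /F; case: ifP => _.
    by rewrite addrC.
  by rewrite add0r.
rewrite bigA_distr coef_sum subset_charE.
rewrite [RHS](bigID (fun J : {set {set 'I_N}} => J \subset porbits w)) /=.
rewrite [X in _ = _ + X]big1 => [|J /subsetPn[Y YJ nY]]; last first.
  by rewrite (bigD1 Y) //= YJ /F (negPf nY) mul0r coef0.
rewrite addr0 (reindex_onto (orbits_in w) cover) => [|J /cover_stab[] //].
rewrite big_mkcondl /=; apply: esym.
rewrite (eq_bigl (fun A => w \in stab A)) => [|A]; last first.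
  rewrite orbits_in_sub; apply/eqP/idP => [<- | ]; last exact: cover_orbits_in.
  by case: (cover_stab (orbits_in_sub w A)).
apply: eq_bigr => A sw.
rewrite -big_mkcond /= (eq_bigr (fun Y : {set 'I_N} => (-1) ^+ (eps && ~~ odd #|Y|) *: 'X^(#|Y|))); last first.
  by move=> Y /(subsetP (orbits_in_sub w A)) PY; rewrite /F PY.
rewrite scaler_prod -sgn_on_orbits // prodrXr coefZ coefXn.
rewrite (eqP (trivIset_porbits (orbits_in_sub w A))) cover_orbits_in // eq_sym.
by case: eqP; rewrite ?mulr1 ?mulr0.
Qed.

Lemma subset_char_cycle_type eps k w :
  subset_char N eps k w = (\prod_(m <- cycle_type w) cycle_factor eps m)`_k.
Proof.
rewrite subset_char_coef /cycle_type (perm_big _ (permEl (perm_sort _ _))) big_map.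
by rewrite big_enum.
Qed.

Lemma subset_char_compl k w : (k <= N)%N ->
  subset_char N false (N - k)%N w = subset_char N false k w.
Proof.
move=> kN; rewrite !subset_charE (reindex_inj (inv_inj (@setCK _))) /=.
apply: eq_big => [A | A _]; last by rewrite /sgn_on.
rewrite astabsC cardsCs setCK card_ord; congr (_ && _).
have AN : (#|A| <= N)%N by rewrite -[N in (_ <= N)%N]card_ord max_card.
by apply/eqP/eqP => [|-> //]; move: AN kN; move: #|A| => a; lia.
Qed.

Lemma subset_char_big eps k w : (N < k)%N -> subset_char N eps k w = 0.
Proof.
move=> Nk; rewrite subset_charE big_pred0 // => A; apply/negbTE.
by apply: contraL Nk => /andP[/eqP <- _]; rewrite -leqNgt -[N in (_ <= N)%N]card_ord max_card.
Qed.

End CycleGeneratingFunction.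

(** * Permutations of given cycle type *)

Section CycleTypeExistence.
Variables (N : nat) (mu : seq nat).
Hypotheses (sum_mu : sumn mu = N) (mu_gt0 : all (fun m => 0 < m)%N mu).

Let row (x : nat) := reshape_index mu x.
Let off (x : nat) := reshape_offset mu x.

Lemma rotate_subproof (x : 'I_N) :
  (flatten_index mu (row x) ((off x).+1 %% nth 0 mu (row x)) < N)%N.
Proof.
rewrite -[ltnRHS]sum_mu; apply/flatten_indexP/ltn_pmod.
by apply: leq_ltn_trans (reshape_offsetP (_ : x < sumn mu)%N); rewrite ?sum_mu.
Qed.

(** Filling the shape [mu] row after row and turning each row by one cell makes the rows the
    cycles. *)
Definition rotate_rows (x : 'I_N) : 'I_N := Ordinal (rotate_subproof x).

Lemma off_lt (x : 'I_N) : (off x < nth 0 mu (row x))%N.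
Proof. by apply: reshape_offsetP; rewrite sum_mu. Qed.

Lemma row_rotate x : row (rotate_rows x) = row x.
Proof. by apply: flatten_indexKl; apply: ltn_pmod; apply: leq_ltn_trans (off_lt x). Qed.

Lemma off_rotate x : off (rotate_rows x) = ((off x).+1 %% nth 0 mu (row x))%N.
Proof. by apply: flatten_indexKr; apply: ltn_pmod; apply: leq_ltn_trans (off_lt x). Qed.

Lemma row_off_inj (x y : 'I_N) : row x = row y -> off x = off y -> x = y.
Proof.
by move=> exy oxy; apply: val_inj; rewrite /= -(reshape_indexK mu x) -/(row x) -/(off x) exy oxy reshape_indexK.
Qed.

Lemma rotate_rows_inj : injective rotate_rows.
Proof.
move=> x y xy; have rxy : row x = row y by rewrite -(row_rotate x) xy row_rotate.
apply: row_off_inj => //; have := off_rotate x; rewrite xy off_rotate -rxy => /eqP.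
have lx := off_lt x; have ly := off_lt y; rewrite -rxy in ly.
by rewrite -(addn1 (off x)) -(addn1 (off y)) eqn_modDr !modn_small // => /eqP.
Qed.

Definition row_rotation : 'S_N := perm rotate_rows_inj.

Lemma row_off_rotationX i x : row ((row_rotation ^+ i)%g x) = row x /\
  off ((row_rotation ^+ i)%g x) = ((off x + i) %% nth 0 mu (row x))%N.
Proof.
elim: i => [|i [IHr IHo]]; first by rewrite expg0 perm1 addn0 modn_small ?off_lt.
rewrite expgSr permM permE row_rotate off_rotate IHr IHo; split=> //.
by rewrite -[X in (X %% _)%N = _]addn1 modnDml addn1 addnS.
Qed.

Definition row_set (r : nat) : {set 'I_N} := [set x : 'I_N | row x == r].

Lemma porbit_row_rotation x : porbit row_rotation x = row_set (row x).
Proof.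
apply/setP => y; rewrite inE; apply/porbitP/eqP => [[i ->] | rxy].
  by case: (row_off_rotationX i x).
(* Go round to the start of the row, then on to [off y]; the subtraction does not truncate. *)
exists (nth 0 mu (row x) - off x + off y)%N; apply: row_off_inj.
  by rewrite (row_off_rotationX _ x).1.
rewrite (row_off_rotationX _ x).2 addnA (subnKC (ltnW (off_lt x))).
by rewrite modnDl modn_small // -rxy off_lt.
Qed.

Lemma card_row_set r : (r < size mu)%N -> #|row_set r| = nth 0 mu r.
Proof.
move=> ltr; have lt_flat (c : 'I_(nth 0 mu r)) : (flatten_index mu r c < N)%N.
  by rewrite -[ltnRHS]sum_mu; apply: flatten_indexP.
pose g c := Ordinal (lt_flat c).
have injg : injective g.
  move=> c d /(congr1 val)/= gcd; apply: val_inj => /=.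
  by rewrite -(flatten_indexKr (ltn_ord c)) gcd flatten_indexKr.
rewrite -[RHS]card_ord -(card_imset _ injg); apply: eq_card => x; rewrite inE.
apply/eqP/imsetP => [rx | [c _ ->]]; last exact: flatten_indexKl.
have ltc : (off x < nth 0 mu r)%N by rewrite -rx off_lt.
by exists (Ordinal ltc) => //; apply: val_inj; rewrite /= -rx reshape_indexK.
Qed.

Lemma porbits_row_rotation :
  perm_eq (enum (porbits row_rotation)) [seq row_set r | r <- iota 0 (size mu)].
Proof.
have row_ex r : (r < size mu)%N -> exists x : 'I_N, row x = r.
  move=> ltr; have : (0 < #|row_set r|)%N by rewrite card_row_set // (allP mu_gt0) ?mem_nth.
  by case/card_gt0P => x; rewrite inE => /eqP; exists x.
apply: uniq_perm; first exact: enum_uniq.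
  rewrite map_inj_in_uniq ?iota_uniq // => r s; rewrite !mem_iota !add0n /=.
  by move=> /row_ex[x rx] _ /setP/(_ x); rewrite !inE rx eqxx => /esym/eqP.
move=> Y; rewrite mem_enum; apply/imsetP/mapP => [[x _ ->] | [r]].
  exists (row x); last exact: porbit_row_rotation.
  by rewrite mem_iota /=; apply: reshape_indexP; rewrite sum_mu.
rewrite mem_iota add0n /= => /row_ex[x <-] ->; exists x => //.
by rewrite porbit_row_rotation.
Qed.

Lemma exists_cycle_type : sorted geq mu -> exists w : 'S_N, cycle_type w = mu.
Proof.
move=> smu; exists row_rotation.
have geq_tr : transitive geq by move=> y x z /= yx zy; apply: leq_trans zy yx.
have geq_tot : total geq by move=> x y; apply: leq_total.
have geq_as : antisymmetric geq by move=> x y /andP[/= yx xy]; apply/eqP; rewrite eqn_leq xy yx.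
rewrite -(sorted_sort geq_tr smu); apply/perm_sortP => //.
apply: perm_trans (perm_map _ porbits_row_rotation) _.
rewrite -map_comp (_ : map _ _ = mu) //; rewrite -[RHS](mkseq_nth 0%N).
by apply/eq_in_map => r; rewrite mem_iota => /card_row_set.
Qed.
End CycleTypeExistence.

(** * Antisymmetry and comparison *)

Lemma cfun_subE (gT : finGroupType) (G : {group gT}) (phi psi : 'CF(G)) x :
  (phi - psi) x = phi x - psi x.
Proof. by rewrite !cfunE. Qed.

Lemma cfun_zeroE (gT : finGroupType) (G : {group gT}) x : (0 : 'CF(G)) x = 0.
Proof. by rewrite cfunE. Qed.

Section CharacterCoefficients.
Variable N : nat.
Implicit Types w : 'S_N.

Lemma two_row_char_coef j w : two_row_char N j w
  = ((1 - 'X) * \prod_(m <- cycle_type w) (1 + 'X^m))`_j.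
Proof.
have XE k : subset_char N false k w = (\prod_(m <- cycle_type w) (1 + 'X^m))`_k.
  rewrite subset_char_cycle_type (eq_bigr (fun m => 1 + 'X^m)) // => m _.
  by rewrite /cycle_factor scale1r.
rewrite mulrBl mul1r coefB coefXM /two_row_char -XE.
by case: j => [|j] /=; rewrite cfun_subE ?cfun_zeroE -?XE.
Qed.

(** Dividing by [1 + 'X] obeys on coefficients the recursion that defines [hook_char]. *)
Lemma hook_char_coef k w (p : {poly algC}) :
    \prod_(m <- cycle_type w) cycle_factor true m = (1 + 'X) * p ->
  hook_char N k w = p`_k.
Proof.
move=> Ep; elim: k => [|k IHk] /=; rewrite cfun_subE ?cfun_zeroE subset_char_cycle_type Ep;
  rewrite mulrDl mul1r coefD coefXM /=; first by rewrite addr0 subr0.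
by rewrite IHk addrK.
Qed.

(** Complementation exchanges the subset characters of index k and N - k; at the two ends the
    vanishing one of index N + 1 stands for the missing predecessor of index 0. *)
Lemma two_row_char_antisym j w : (j <= N.+1)%N ->
  two_row_char N (N.+1 - j)%N w = - two_row_char N j w.
Proof.
rewrite /two_row_char; case: j => [|j] jN.
  by rewrite subn0 !cfun_subE cfun_zeroE subr0 (subset_char_big _ _ (ltnSn N)) -(subset_char_compl w (leq0n N)) subn0 add0r.
rewrite subSS; move: jN; rewrite ltnS leq_eqVlt => /predU1P[->|jN].
  rewrite subnn !cfun_subE cfun_zeroE subr0 (subset_char_big _ _ (ltnSn N)) -(subset_char_compl w (leqnn N)).
  by rewrite subnn sub0r opprK.
rewrite -(subnSK jN) !cfun_subE (subnSK jN) subset_char_compl ?subset_char_compl ?(ltnW jN) //.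
by rewrite opprB.
Qed.
End CharacterCoefficients.

(** The reflection j -> n + 1 - j matches the two halves of the range. *)
Lemma sum_sqr_antisym (R : comNzRingType) n (g : nat -> R) :
    (forall j, (j <= n.+1)%N -> g (n.+1 - j)%N = - g j) -> (forall x : R, x = - x -> x = 0) ->
  \sum_(0 <= j < n.+2) g j ^+ 2 = (\sum_(0 <= j < n./2.+1) g j ^+ 2) *+ 2.
Proof.
move=> gE char2.
have half m : (n = odd n + m.*2)%N -> \sum_(odd n + m.+1 <= j < n.+2) g j ^+ 2
    = \sum_(0 <= j < m.+1) g j ^+ 2.
  move=> nE; rewrite big_nat_rev /= -{1}[(odd n + m.+1)%N]add0n big_addn.
  have -> : (n.+2 - (odd n + m.+1) = m.+1)%N by move: nE; lia.
  rewrite big_nat [RHS]big_nat; apply: eq_bigr => j /andP[_ jm].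
  have -> : (odd n + m.+1 + n.+2 - (j + (odd n + m.+1)).+1 = n.+1 - j)%N by lia.
  by rewrite gE ?sqrrN //; move: nE; lia.
have nE : (n = odd n + n./2.*2)%N by rewrite odd_double_half.
rewrite (@big_cat_nat _ _ _ n./2.+1) //=; last by move: nE; lia.
rewrite mulr2n; congr (_ + _); rewrite -[RHS]half //.
case: (boolP (odd n)) nE => odd_n nE //.
(* For odd [n] the middle index is its own reflection, so its term is 0. *)
rewrite big_ltn; last by move: nE; lia.
suff -> : g n./2.+1 = 0 by rewrite expr0n add0r.
by apply: char2; rewrite -gE; [congr g|]; move: nE; lia.
Qed.

(** The choice of [w] depends on [mu] alone, so one [w] serves all shapes; existence rules out the
    default value. *)
Lemma chi_specht N mu : sumn mu = N -> all (fun m => 0 < m)%N mu -> sorted geq mu ->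
  exists2 w : 'S_N, cycle_type w = mu & forall la, chi N la mu = specht_char N la w.
Proof.
move=> sum_mu mu_gt0 smu; rewrite /chi; case: pickP => [w /eqP wmu | none].
  by exists w.
by have [w wmu] := exists_cycle_type sum_mu mu_gt0 smu; have := none w; rewrite wmu eqxx.
Qed.

(** * Padded partitions and the product identity *)

Lemma perm_sort_geq (s : seq nat) : perm_eq (sort geq s) s.
Proof. by rewrite perm_sort. Qed.

Lemma pad1_partition (s : seq nat) N : all (fun m => 0 < m)%N s -> (sumn s <= N)%N ->
  let mu := pad1 (sort geq s) N in
  [/\ sumn mu = N, all (fun m => 0 < m)%N mu & sorted geq mu].
Proof.
move=> s_gt0 sN; have s_gt0' : all (fun m => 0 < m)%N (sort geq s).
  by rewrite (perm_all _ (perm_sort_geq s)).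
rewrite /pad1 (perm_sumn (perm_sort_geq s)) /=; split.
- by rewrite sumn_cat sumn_nseq (perm_sumn (perm_sort_geq s)) mul1n subnKC.
- by rewrite all_cat s_gt0' all_nseq orbT.
have geq_tr : transitive geq by move=> y x z /= yx zy; apply: leq_trans zy yx.
rewrite sorted_pairwise // pairwise_cat; apply/and3P; split.
- by apply/allrelP => x y xs /nseqP[-> _]; apply: (allP s_gt0').
- rewrite -sorted_pairwise //; apply: sort_sorted => x y; exact: leq_total.
by elim: (N - _)%N => //= m ->; rewrite all_nseq orbT.
Qed.

Lemma prod_pad1 (R : comNzRingType) (F : nat -> R) s N :
  \prod_(m <- pad1 (sort geq s) N) F m = (\prod_(m <- s) F m) * F 1%N ^+ (N - sumn s).
Proof.
rewrite /pad1 big_cat (perm_big _ (perm_sort_geq s)) (perm_sumn (perm_sort_geq s)) /=.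
by rewrite big_nseq; congr (_ * _); elim: (N - _)%N => //= m ->; rewrite exprS.
Qed.

(** Telescoping by (1 - y)(1 + y) = 1 - y^2. *)
Lemma prod_one_plus_powers2 (R : comNzRingType) (x : R) t :
  (1 - x ^+ 2) * \prod_(i <- iota 1 t) (1 + x ^+ (2 ^ i)) = 1 - x ^+ (2 ^ t.+1).
Proof.
elim: t => [|t IHt]; first by rewrite big_nil mulr1.
rewrite -[in iota 1 _](addn1 t) iotaD big_cat big_seq1 /= mulrA IHt add1n.
by rewrite (expnS 2 t.+1) mulnC exprM; ring.
Qed.

Lemma sumn_powers2 t : (sumn [seq 2 ^ i | i <- iota 1 t] + 2 = 2 ^ t.+1)%N.
Proof.
elim: t => // t IHt; rewrite -[in iota 1 _](addn1 t) iotaD map_cat sumn_cat /=.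
by rewrite addn0 add1n addnAC IHt [in RHS]expnS mul2n addnn.
Qed.

Theorem mainTheorem1 (s t : nat) (a : s.-tuple nat)
    (ht : (1 <= t)%N)
    (ha_sorted : sorted geq a)
    (ha_odd : forall i : 'I_s, odd (tnth a i) /\ (3 <= tnth a i)%N)
    (n : nat) (hn : (sumn (mu0 a t) <= n)%N) :
  A (mu0 a t) n = 2%:R^-1 * B (mu0' a t) (n + 2)%N.
Proof.
have a_odd m : m \in (a : seq nat) -> odd m /\ (3 <= m)%N.
  by case/tnthP => i ->; apply: ha_odd.
have a_gt0 : all (fun m => 0 < m)%N a by apply/allP => m /a_odd[_]; lia.
pose q := [seq (2 ^ i)%N | i <- iota 1 t.-1].
(* The weights of the two partitions differ by 2, as do n and n + 2, so both are padded with equally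
   many ones. *)
have sum_q : (sumn q + 2 = 2 ^ t)%N by rewrite sumn_powers2 prednK.
have q_gt0 : all (fun m => 0 < m)%N q.
  by apply/allP => _ /mapP[i _ ->]; rewrite expn_gt0.
have sum0 : (sumn (a ++ q) <= n)%N by rewrite -(perm_sumn (perm_sort_geq _)).
have sum1 : (sumn (rcons a (2 ^ t)) <= n + 2)%N.
  by move: sum0; rewrite sumn_rcons sumn_cat -sum_q; lia.
have [] := pad1_partition _ sum0; first by rewrite all_cat a_gt0.
move=> /chi_specht/[apply]/[apply] [[w wE chiw]].
have [] := pad1_partition _ sum1; first by rewrite all_rcons expn_gt0.
move=> /chi_specht/[apply]/[apply] [[w' w'E chiw']].
pose P : {poly algC} := (1 - 'X) * \prod_(m <- cycle_type w) (1 + 'X^m).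
(* Odd parts and ones give equal factors on both sides. The rest is 1 - q^(2^t) = (1 + q)(1 - q)
   times the product of the 1 + q^(2^i), with q for ['X]. *)
have factor : \prod_(m <- cycle_type w') cycle_factor true m = (1 + 'X) * P.
  rewrite w'E /P wE !prod_pad1 big_rcons big_cat big_map /=.
  have -> : \prod_(m <- a) cycle_factor true m = \prod_(m <- a) (1 + 'X^m).
    apply: eq_big_seq => m /a_odd[odd_m _].
    by rewrite /cycle_factor odd_m scale1r.
  have -> : (n + 2 - sumn (rcons a (2 ^ t)) = n - sumn (a ++ q))%N.
    by rewrite sumn_rcons sumn_cat -sum_q; lia.
  have -> : cycle_factor true (2 ^ t) = 1 - 'X^(2 ^ t).
    by rewrite /cycle_factor oddX eqn0Ngt ht /= expr1 scaleN1r.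
  have -> : cycle_factor true 1 = 1 + 'X by rewrite /cycle_factor scale1r.
  have := @prod_one_plus_powers2 _ ('X : {poly algC}) t.-1; rewrite prednK // => <-.
  by rewrite expr1; ring.
have two_rowP j : two_row_char n j w = P`_j by apply: two_row_char_coef.
have hookP k : hook_char (n + 2) k w' = P`_k by apply: hook_char_coef.
have -> : A (mu0 a t) n = \sum_(0 <= j < n./2.+1) P`_j ^+ 2.
  rewrite /A; apply: eq_big_nat => j /andP[_ jn].
  by rewrite chiw specht_two_row ?two_rowP //; lia.
have -> : B (mu0' a t) (n + 2) = \sum_(0 <= k < n.+2) P`_k ^+ 2.
  (* Reversing the sum replaces the arm length [j] by the leg length k = n + 2 - j, from 0 to n +
     1. *)
  rewrite /B big_add1 /= addn2 big_nat_rev; apply: eq_big_nat => k /andP[_ kn].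
  rewrite add0n -addn2 chiw'; have -> : (n + 2 - k.+1).+1 = (n + 2 - k)%N by lia.
  by rewrite specht_hook ?hookP //; lia.
rewrite (@sum_sqr_antisym _ n) => [|j jn|x].
- by rewrite mulrnAr -mulrnAl -(mulr_natr 2%:R^-1 2) mulVf ?pnatr_eq0 ?mul1r.
- by rewrite -!two_rowP two_row_char_antisym.
by move/eqP; rewrite eq_sym eqNr => /eqP.
Qed.
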